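(* Let $K>2$ be an integer, let $\mathcal{T}$ be the canopy tree of degree $K+1$, and let $l\geq 2$ be an integer. Let $\{\omega_x\}_{x\in\mathcal{N}}$ be independent identically distributed real random variables whose common distribution $\mu$ is absolutely continuous, where $\mathcal{N}=\bigcup_{m\in\mathbb{N}\cup\{0\}}\mathcal{V}_{m(l+1)+l}$, and define on $\ell^2(\mathcal{T})$ the random operator $$H^\omega_{\mathcal{T}}=\Delta_{\mathcal{T}}+\sum_{x\in\mathcal{N}}\omega_x P_{\Lambda_l(x)}.$$ Then, almost surely, $$\sigma(\Delta_{l-1})+\operatorname{supp}(\mu)\subset\sigma_{pp}(H^\omega_{\mathcal{T}}),$$ and the maximum multiplicity of the point spectrum of $H^\omega_{\mathcal{T}}$ in $\sigma(\Delta_{l-1})+\operatorname{supp}(\mu)$ is at least $K-1$, i.e. $\sup\{\dim\ker(H^\omega_{\mathcal{T}}-\lambda):\lambda\in\sigma(\Delta_{l-1})+\operatorname{supp}(\mu)\}\geq K-1$.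
   Context: Graphs are undirected without self-loops: a graph is a pair $(\mathcal{V},\mathcal{E})$ with $\mathcal{E}$ a set of two-element subsets of $\mathcal{V}$. Canopy tree: the canopy tree $\mathcal{T}$ of degree $K+1$ is the graph $(\mathcal{V},\mathcal{E})$ with $\mathcal{V}=\mathbb{Z}\times(\mathbb{N}\cup\{0\})$ and $$\mathcal{E}=\left\{\left\{(x,n),\left(\left\lfloor \tfrac{x}{K}\right\rfloor,n+1\right)\right\}:x\in\mathbb{Z},\,n\in\mathbb{N}\cup\{0\}\right\}.$$ Its boundary is $\partial\mathcal{T}=\{(y,0):y\in\mathbb{Z}\}$, and $\mathcal{V}_i=\{(y,i):y\in\mathbb{Z}\}$ for $i\in\mathbb{N}\cup\{0\}$ is the set of vertices at distance $i$ from the boundary. Let $d$ be the graph distance (length of the shortest path, $\infty$ if there is no path), and $d(v,\partial\mathcal{T})$ the distance of $v$ from the boundary. Write $v\prec w$ if $d(v,\partial\mathcal{T})\leq d(w,\partial\mathcal{T})$ and $d(v,w)=d(w,\partial\mathcal{T})-d(v,\partial\mathcal{T})$. For $w\in\mathcal{V}$ and $l\in\mathbb{N}$, let $$\Lambda_l(w)=\{v\in\mathcal{V}:v\prec w,\ d(v,w)\leq l\},$$ also regarded as a tree with the edges obtained by restricting those of $\mathcal{T}$. Operators: $\ell^2(\mathcal{T})=\ell^2(\mathcal{V})$; the adjacency operator is $(\Delta_{\mathcal{T}}u)(v)=\sum_{d(v,w)=1}u(w)$; for $S\subset\mathcal{V}$, $P_S$ is the projection $(P_Su)(v)=u(v)$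 if $v\in S$ and $0$ otherwise. For $n\in\mathbb{N}$, $\Delta_n$ is the adjacency matrix of the finite tree $\Lambda_n(x)$ for $x\in\mathcal{V}_n$ (all these trees are isomorphic, so $\sigma(\Delta_n)$ does not depend on $x$). $H^\omega_{\mathcal{T}}$ is the sum of a bounded self-adjoint operator and a real multiplication operator, taken self-adjoint on the natural (maximal) domain of the multiplication operator. $\sigma_{pp}(H)$ is the pure point spectrum, i.e. the closure of the set of eigenvalues of $H$. For sets $A,B\subset\mathbb{R}$, $A+B=\{a+b:a\in A,b\in B\}$, and $\operatorname{supp}(\mu)$ is the topological support of $\mu$. *)

(* Defs.v *)
From HB Require Import structures.
From mathcomp Require Import all_boot all_order all_algebra.
From mathcomp Require Import finmap.
From mathcomp Require Import all_classical all_reals all_analysis.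
From mathcomp Require Import complex.

Set Implicit Arguments.
Unset Strict Implicit.
Unset Printing Implicit Defensive.

Import Order.TTheory GRing.Theory Num.Theory.
Import numFieldNormedType.Exports.

Local Open Scope classical_set_scope.
Local Open Scope complex_scope.
Local Open Scope ring_scope.

Section Graph.
Variables (R : realType) (V : choiceType) (e : rel V).

(* +oo when no path joins v to w *)
Definition gdist (v w : V) : \bar R :=
  ereal_inf [set (size p)%:R%:E | p in [set p | path e v p /\ last v p = w]].

Definition gdist_set (v : V) (A : set V) : \bar R :=
  ereal_inf [set gdist v w | w in A].

(* fsbigop sums with infinite support are 0; this does not occur in locally
   finite graphs. *)
Definition adj_op (u : V -> R[i]) (v : V) : R[i] :=
  \sum_(w \in [set w | gdist v w = 1%E]) u w.

Definition adj_mx (A : {fset V}) : 'M[R]_#|{: A}| :=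
  \matrix_(i, j) (e (val (enum_val i)) (val (enum_val j)))%:R.

End Graph.

Section Operators.
Variables (R : realType) (V : choiceType).
Implicit Types (u : V -> R[i]) (D : set (V -> R[i]))
  (H : (V -> R[i]) -> V -> R[i]).

Definition ell2 : set (V -> R[i]) :=
  [set u | (\esum_(v in [set: V]) ((Normc.normc (u v)) ^+ 2)%:E < +oo)%E].

Definition proj (S : set V) u (v : V) : R[i] := if v \in S then u v else 0.

(* Unbounded operators are given by a domain D and a map H used only on D.
   The operators considered are self-adjoint, so that only real spectral
   parameters are needed. *)
Definition eigenker D H (lambda : R) : set (V -> R[i]) :=
  [set u | D u /\ forall v, H u v = lambda%:C * u v].

Definition eigenvalues D H : set R :=
  [set lambda | exists2 u, eigenker D H lambda u & exists v, u v != 0].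

Definition sigma_pp D H : set R := closure (eigenvalues D H).

Definition lin_indep (n : nat) (f : 'I_n -> V -> R[i]) : Prop :=
  forall c : 'I_n -> R[i],
    (forall v, \sum_(i < n) c i * f i v = 0) -> forall i, c i = 0.

(* complex dimension of a linear subspace, possibly +oo *)
Definition dimension (S : set (V -> R[i])) : \bar R :=
  ereal_sup [set n%:R%:E | n in [set n |
    exists2 f : 'I_n -> V -> R[i], (forall i, S (f i)) & lin_indep f]].

End Operators.

Definition cvertex := (int * nat)%type.

Section Canopy.
Variables (R : realType) (K : nat).

(* divz by K > 0 rounds towards -oo *)
Definition parent (v : cvertex) : cvertex := ((v.1 %/ K%:Z)%Z, v.2.+1).

Definition canopy : rel cvertex :=
  fun v w => (w == parent v) || (v == parent w).

Definition level (i : nat) : set cvertex := [set v | v.2 = i].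

Definition boundary : set cvertex := level 0.

Definition bdist (v : cvertex) : \bar R := gdist_set R canopy v boundary.

Definition prec (v w : cvertex) : Prop :=
  (bdist v <= bdist w)%E /\ gdist R canopy v w = (bdist w - bdist v)%E.

Definition Lambda (l : nat) (w : cvertex) : set cvertex :=
  [set v | prec v w /\ (gdist R canopy v w <= l%:R%:E)%E].

(* Intended for x in level n.  The set Lambda n x is finite, so that
   fset_set (Lambda n x) has the same elements. *)
Definition sigma_Delta (n : nat) (x : cvertex) : set R :=
  [set a | eigenvalue (adj_mx R canopy (fset_set (Lambda n x))) a].

Definition sites (l : nat) : set cvertex :=
  \bigcup_(m in [set: nat]) level (m * l.+1 + l).

Variables (l : nat) (w : cvertex -> R).

(* Pointwise only finitely many terms are nonzero: the sets Lambda l x, x in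
   sites l, are disjoint. *)
Definition block_potential (u : cvertex -> R[i]) (v : cvertex) : R[i] :=
  \sum_(x \in sites l) (w x)%:C * proj (Lambda l x) u v.

Definition canopy_H (u : cvertex -> R[i]) (v : cvertex) : R[i] :=
  adj_op canopy u v + block_potential u v.

Definition canopy_dom : set (cvertex -> R[i]) :=
  [set u | ell2 u /\ ell2 (block_potential u)].

End Canopy.

Section Probability.
Context d (T : measurableType d) (R : realType) (P : probability T R).
Local Open Scope ereal_scope.

Definition mutually_independent (I : choiceType) (A : set I)
    (X : I -> {RV P >-> R}) : Prop :=
  forall (J : {fset I}) (B : I -> set R),
    [set` J] `<=` A -> (forall i, measurable (B i)) ->
    P (\bigcap_(i in [set` J]) X i @^-1` B i) =
    \prod_(i <- J) P (X i @^-1` B i).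

Definition identically_distributed (I : choiceType) (A : set I)
    (X : I -> {RV P >-> R}) (mu : probability (measurableTypeR R) R) : Prop :=
  forall i, A i -> forall B : set R, measurable B ->
    distribution P (X i) B = mu B.

End Probability.

Definition msupp (R : realType) (mu : probability (measurableTypeR R) R) :
    set R :=
  [set x | forall U : set R, open U -> U x -> (0 < mu U)%E].

Definition setadd (R : realType) (A B : set R) : set R :=
  [set a + b | a in A & b in B].

(* Main.v *)
Require Import Defs.
From mathcomp Require Import all_boot all_order all_algebra.
From mathcomp Require Import all_classical all_reals all_analysis.
From mathcomp Require Import measurable_realfun finmap complex.
From mathcomp Require Import zify.

Set Implicit Arguments.
Unset Strict Implicit.
Unset Printing Implicit Defensive.

Import Order.TTheory GRing.Theory Num.Theory.
Import numFieldNormedType.Exports.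

Local Open Scope classical_set_scope.
Local Open Scope ring_scope.

(** The eigenvectors responsible for the theorem live in the blocks that touch
    the boundary, and their eigenvalues are explicit.  A vertex [x] of level
    [l] has [K] children, and the subtrees below them are copies of
    [Lambda_{l-1}].  Put an eigenvector [phi] of [Delta_{l-1}], with eigenvalue
    [a], on the subtree below one child, and [- phi] on the subtree below
    another one.  The adjacency operator multiplies the resulting function by
    [a] inside the two subtrees; the only other vertex at which it could be
    nonzero is [x], where the two contributions [phi y] and [- phi y] of the
    roots cancel.  The function is supported in [Lambda_l(x)], where the random
    potential is the constant [omega_x], so it is an eigenvector of [H] for
    [a + omega_x] ([sibling_difference_eigenvector]).  Comparing the first child
    with each of the others gives [K - 1] independent eigenvectors
    ([independent_eigenvectors]).

    It remains to let [x] run through the level [l].  The variables [omega_x]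
    are independent with law [mu], so almost surely a given one lies in
    the support of [mu] ([ae_msupp]), while together their values are dense in
    the support ([ae_dense_msupp]): a set of positive measure is
    missed by the first [m] of them with probability [q ^ m] for some [q < 1].
    Density gives the inclusion into the closure of the set of eigenvalues.

    The multiplicity bound also needs one real eigenvalue of [Delta_{l-1}]; as
    [l >= 2], two leaves with the same parent exist and have equal rows in the
    adjacency matrix, so [0] is an eigenvalue ([sigma_Delta0]). *)

(** * Graph distance and paths *)

Section GraphDistance.
Variables (R : realType) (V : choiceType) (e : rel V).

Lemma gdist_ge (v w : V) (n : nat) :
  (forall p, path e v p -> last v p = w -> (n <= size p)%N) ->
  (n%:R%:E <= gdist R e v w)%E.
Proof.
move=> H; apply: le_ereal_inf_tmp => _ [p [pp lp] <-].
by rewrite lee_fin ler_nat H.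
Qed.

Lemma gdist_le (v : V) p : path e v p ->
  (gdist R e v (last v p) <= (size p)%:R%:E)%E.
Proof. by move=> pp; apply: ge_ereal_inf; exists (size p)%:R%:E => //; exists p. Qed.

(** The lengths are natural numbers, so the infimum defining a finite distance
    is attained. *)
Lemma gdist_path (v w : V) (n : nat) : (gdist R e v w <= n%:R%:E)%E ->
  exists p, [/\ path e v p, last v p = w & (size p <= n)%N].
Proof.
move=> dn; apply: contrapT => H.
have : (n.+1%:R%:E <= gdist R e v w)%E.
  apply: gdist_ge => p pp lp; rewrite ltnNge; apply/negP => sp.
  by apply: H; exists p.
by move=> /le_trans/(_ dn); rewrite lee_fin ler_nat ltnn.
Qed.

Lemma gdist1 (v w : V) : ~~ e v v -> gdist R e v w = 1%E <-> e v w.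
Proof.
move=> ev; split => [d1|evw].
  have [[|x [|y p]] [pp lp sp]] := @gdist_path v w 1 ltac:(by rewrite d1).
  - have := @gdist_le v [::] isT; rewrite lp d1.
    by rewrite lee_fin ler10.
  - by move: pp lp => /=; rewrite andbT => + <-.
  - by [].
apply/le_anti/andP; split.
  have /= := @gdist_le v [:: w]; rewrite evw; exact.
apply: (@gdist_ge v w 1) => -[|//] _ /= vw.
by move: evw; rewrite -vw (negPf ev).
Qed.

End GraphDistance.

(** * Geometry of the canopy tree *)

Section Geometry.
Variables (R : realType) (K : nat).
Hypothesis K_gt0 : (0 < K)%N.
Implicit Types v w : cvertex.

Lemma iter_parent k v :
  iter k (parent K) v = ((v.1 %/ (K ^ k)%N%:Z)%Z, (v.2 + k)%N).
Proof.
elim: k => [|k IH]; first by rewrite /= expn0 divz1 addn0 -surjective_pairing.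
by rewrite iterS IH /parent /= expnSr PoszM divzMA_ge0// addnS.
Qed.

Lemma canopy_irr v : ~~ canopy K v v.
Proof. by rewrite /canopy orbb; apply/eqP => /(congr1 snd)/= /eqP; lia. Qed.

(** Every edge changes the level by one.  A path climbing at full speed can only
    use edges towards parents, so it is the chain of ancestors of its origin. *)
Lemma canopy_path v p : path (canopy K) v p ->
  [/\ (v.2 <= (last v p).2 + size p)%N, ((last v p).2 <= v.2 + size p)%N &
      (last v p).2 = (v.2 + size p)%N ->
      last v p = iter (size p) (parent K) v].
Proof.
elim: p v => [|w p IH] v /=; first by split => //; lia.
move=> /andP[/orP[]/eqP vw]; last first.
  move=> /IH[h1 h2 h3]; rewrite vw /= in h1 h2 h3 *; split; lia.
move=> /IH[h1 h2 h3].
rewrite vw /= in h1 h2 h3 *; split; [lia|lia|move=> h].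
by rewrite -iterS iterSr h3//; lia.
Qed.

Lemma gdist_iter_parent k v :
  gdist R (canopy K) v (iter k (parent K) v) = k%:R%:E.
Proof.
apply/le_anti/andP; split; last first.
  apply: gdist_ge => p pp lp; have [_ + _] := canopy_path pp.
  by rewrite lp iter_parent leq_add2l.
have : path (canopy K) v (traject (parent K) (parent K v) k).
  apply: (@sub_path _ (frel (parent K))); last exact: fpath_traject.
  by move=> x y /= /eqP <-; rewrite /canopy eqxx.
by move=> /(gdist_le R); rewrite last_traject size_traject.
Qed.

(** Follow first children down to level [0]. *)
Lemma path_to_boundary v :
  exists p, [/\ path (canopy K) v p, (last v p).2 = 0%N & size p = v.2].
Proof.
case: v => x n; elim: n x => [|n IH] x; first by exists [::].
have [p [pp lp sp]] := IH (x * K%:Z); exists ((x * K%:Z, n) :: p); split => //=.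
  by rewrite pp andbT /canopy /parent /= mulzK ?eqxx ?orbT//; lia.
by rewrite sp.
Qed.

Lemma bdistE v : bdist R K v = v.2%:R%:E.
Proof.
apply/le_anti/andP; split.
  have [p [pp lp sp]] := path_to_boundary v.
  apply: ge_ereal_inf; exists (gdist R (canopy K) v (last v p)).
    by exists (last v p).
  by rewrite -sp; exact: gdist_le.
apply: le_ereal_inf_tmp => _ [w w0 <-]; apply: gdist_ge => p pp lp.
by have [+ _ _] := canopy_path pp; rewrite lp w0.
Qed.

(** Turns the relation [prec], phrased with distances, into arithmetic: the
    geodesic from [v] to an ancestor is the chain of parents, and iterating
    [parent] divides the first coordinate by a power of [K]. *)
Lemma LambdaE n w v : Lambda R K n w v <->
  [/\ (v.2 <= w.2)%N, (w.2 <= v.2 + n)%N &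
      w.1 = (v.1 %/ (K ^ (w.2 - v.2))%N%:Z)%Z].
Proof.
split=> [[[]]|[h1 h2 h3]].
  rewrite !bdistE lee_fin ler_nat => vw; rewrite -EFinB -natrB// => dE dn.
  rewrite dE lee_fin ler_nat in dn; split => //; first by lia.
  have [p [pp lp sp]] := gdist_path (eq_ind_r (fun x => (x <= _)%E) (lexx _) dE).
  have [_ + +] := canopy_path pp; rewrite lp -{1 2}(subnKC vw).
  rewrite leq_add2l => h1; have -> : size p = (w.2 - v.2)%N.
    by apply/eqP; rewrite eqn_leq sp h1.
  by move=> /(_ erefl); rewrite iter_parent => {1}->.
have wE : w = iter (w.2 - v.2) (parent K) v.
  by rewrite iter_parent -h3 subnKC//; case: (w).
have dE : gdist R (canopy K) v w = (w.2 - v.2)%:R%:E.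
  by rewrite {1}wE gdist_iter_parent.
split; last by rewrite dE lee_fin ler_nat; lia.
by split; rewrite !bdistE ?lee_fin ?ler_nat// dE -EFinB -natrB.
Qed.

Definition child v (j : nat) : cvertex := (v.1 * K%:Z + j%:Z, v.2.-1).

Lemma divz_child (x : int) (j : nat) : (j < K)%N ->
  ((x * K%:Z + j%:Z) %/ K%:Z)%Z = x.
Proof. by move=> jK; rewrite divzMDl ?divz_small ?addr0//; lia. Qed.

Lemma canopy_childP v w : v = parent K w <->
  (0 < v.2)%N /\ exists j : 'I_K, w = child v j.
Proof.
split=> [->|[v0 [j ->]]]; last first.
  by rewrite /parent /child/= divz_child// prednK//; case: (v).
split=> //; have jK : (`|(w.1 %% K%:Z)%Z|%N < K)%N by lia.
exists (Ordinal jK); rewrite /child /= gez0_abs; last by lia.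
by rewrite -divz_eq; case: (w).
Qed.

Definition neighbours v : seq cvertex :=
  parent K v :: if v.2 is 0%N then [::] else [seq child v j | j : 'I_K].

Lemma mem_neighbours v w : (w \in neighbours v) = canopy K v w.
Proof.
rewrite inE /canopy; congr (_ || _); apply/idP/eqP.
  case E : v.2 => [//|n] /mapP[j _ ->]; apply/canopy_childP.
  by rewrite E; split=> //; exists j.
move=> /canopy_childP[]; case E : v.2 => [//|n] _ [j ->].
by apply/mapP; exists j; rewrite // mem_enum.
Qed.

Lemma neighbours_uniq v : uniq (neighbours v).
Proof.
rewrite /=; case E : v.2 => [//|n]; rewrite map_inj_uniq ?enum_uniq.
  rewrite andbT; apply/mapP => -[j _] /(congr1 snd)/=; lia.
by move=> i j [] /addrI[] /val_inj.
Qed.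

(** The finitely many neighbours are the parent and the [K] children; from here
    on the adjacency operator is a finite sum. *)
Lemma adj_opE (u : cvertex -> R[i]) v :
  adj_op (canopy K) u v = u (parent K v) +
    if v.2 is 0%N then 0 else \sum_(j < K) u (child v j).
Proof.
rewrite /adj_op (_ : [set w | _] = [set` neighbours v]).
  rewrite -fsbig_seq ?neighbours_uniq// big_cons; congr (_ + _).
  by case: (v.2) => [|n]; rewrite ?big_nil// big_map big_enum.
apply/seteqP; split=> w /=; rewrite mem_neighbours => /gdist1; apply;
  exact: canopy_irr.
Qed.

Lemma finite_Lambda n w : finite_set (Lambda R K n w).
Proof.
pose g (p : nat * nat) : cvertex :=
  (w.1 * (K ^ p.1)%N%:Z + p.2%:Z, (w.2 - p.1)%N).
apply: (@sub_finite_set _ _ (g @` (`I_n.+1 `*` `I_(K ^ n)))); last first.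
  by apply: finite_image; apply: finite_setX; exact: finite_II.
move=> v /LambdaE[h1 h2 h3]; set k := (w.2 - v.2)%N in h3.
have Kk : (0 < K ^ k)%N by rewrite expn_gt0 K_gt0.
have kn : (k <= n)%N by rewrite /k; lia.
have Kkn : (K ^ k <= K ^ n)%N by rewrite leq_pexp2l.
(* A descendant [k] levels below [w] is [w.1 * K ^ k + r] with [r < K ^ k]. *)
exists (k, `|(v.1 %% (K ^ k)%N%:Z)%Z|%N) => /=.
  by split => /=; [rewrite ltnS | apply: leq_trans Kkn; lia].
rewrite /g /= h3 gez0_abs ?modz_ge0//; last lia.
by rewrite -divz_eq /k subKn//; case: (v).
Qed.

End Geometry.

(** * Eigenfunctions of a finite subtree *)

Section DirichletEigenfunctions.
Variables (R : realType) (K n : nat).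
Hypothesis K_gt0 : (0 < K)%N.
Implicit Types v w y : cvertex.
Implicit Types phi : cvertex -> R[i].

Notation supported phi y := (forall v, phi v != 0 -> Lambda R K n y v).

Lemma subtreeE y v : y.2 = n -> Lambda R K n y v <->
  (v.2 <= n)%N /\ y.1 = (v.1 %/ (K ^ (n - v.2))%N%:Z)%Z.
Proof.
move=> yn; split=> [/(LambdaE R K_gt0)|[h1 h2]]; rewrite ?yn; first by case.
by apply/(LambdaE R K_gt0); rewrite yn; split => //; lia.
Qed.

Lemma subtree_parent y v : y.2 = n -> (v.2 < n)%N ->
  Lambda R K n y (parent K v) <-> Lambda R K n y v.
Proof.
move=> yn vn; have E : (n - v.2)%N = (n - v.2.+1).+1 by lia.
have D : (v.1 %/ (K ^ (n - v.2))%N%:Z)%Z =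
    ((v.1 %/ K%:Z)%Z %/ (K ^ (n - v.2.+1))%N%:Z)%Z.
  by rewrite E expnS PoszM divzMA_ge0.
by split=> /(subtreeE _ yn)[h1 h2]; apply/(subtreeE _ yn);
  rewrite /= ?D in h2 *; split => //; lia.
Qed.

(** Among the vertices of level at most [n] the subtree below [y] is a connected
    component, so a function supported there only leaks out at [parent K y]. *)
Lemma subtree_adjacent y v w : y.2 = n -> (w.2 <= n)%N -> canopy K v w ->
  Lambda R K n y v -> Lambda R K n y w.
Proof.
move=> yn wn /orP[]/eqP E; last first.
  have [wn'|wn'] := ltnP w.2 n; first by rewrite E => /(subtree_parent yn wn').
  by move=> /(subtreeE _ yn); rewrite E /=; lia.
by move=> H; rewrite E; apply/(subtree_parent yn) => //; move: wn; rewrite E.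
Qed.

Lemma subtree_top y v : y.2 = n -> (n <= v.2)%N -> Lambda R K n y v -> v = y.
Proof.
move=> yn nv /(subtreeE _ yn)[h]; have -> : v.2 = n by lia.
rewrite subnn expn0 divz1 => E; rewrite [v]surjective_pairing -E.
by rewrite (_ : v.2 = y.2) -?surjective_pairing//; lia.
Qed.

Lemma supported_above phi y v : y.2 = n -> supported phi y ->
  (n < v.2)%N -> phi v = 0.
Proof.
move=> yn sphi nv; have [//|/sphi/(subtreeE _ yn)[]] := eqVneq (phi v) 0; lia.
Qed.

(** The leak above the subtree only involves the value at its root; this is
    what makes two siblings cancel. *)
Lemma adj_op_above_subtree phi y v : y.2 = n -> supported phi y ->
  (n < v.2)%N ->
  adj_op (canopy K) phi v = if v == parent K y then phi y else 0.
Proof.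
move=> yn sphi nv.
have phi0 w : (n <= w.2)%N -> w <> y -> phi w = 0.
  move=> nw wy; have [//|/sphi/(subtree_top yn nw)] := eqVneq (phi w) 0.
  by move=> /wy.
rewrite adj_opE// phi0 ?add0r/=; [|lia|move=> /(congr1 snd)/=; lia].
case Ev : (v.2) nv => [//|m]; rewrite ltnS => nm.
have nc j : (n <= (child K v j).2)%N by rewrite /= Ev.
case: eqP => [/(canopy_childP K_gt0)[_ [j yj]]|vy].
  rewrite (bigD1 j)//= big1 ?addr0 -?yj// => i ij.
  apply: phi0 (nc _) _; rewrite yj => -[] /addrI[] /val_inj ji.
  by rewrite ji eqxx in ij.
rewrite big1// => j _; apply: phi0 (nc _) _ => jy; apply: vy.
by apply/(canopy_childP K_gt0); rewrite Ev -jy; split => //; exists j.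
Qed.

(** Moves each root of level [n] by [s] and carries its subtree along.  Above
    level [n] the truncated subtraction makes the formula meaningless, but it is
    only applied to functions that vanish there. *)
Definition translate (s : int) v : cvertex :=
  (v.1 + s * (K ^ (n - v.2))%N%:Z, v.2).

Lemma parent_translate s v : (v.2 < n)%N ->
  parent K (translate s v) = translate s (parent K v).
Proof.
move=> vn; rewrite /parent /translate /=.
rewrite (_ : n - v.2 = (n - v.2.+1).+1)%N; last by lia.
by rewrite expnSr PoszM mulrA addrC divzMDl 1?addrC//; lia.
Qed.

Lemma child_translate s v j : (0 < v.2)%N -> (v.2 <= n)%N ->
  child K (translate s v) j = translate s (child K v j).
Proof.
move=> v0 vn; rewrite /child /translate /=.
rewrite (_ : n - v.2.-1 = (n - v.2).+1)%N; last by lia.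
by rewrite expnSr PoszM mulrDl mulrA addrAC.
Qed.

Lemma subtree_translate s y v : y.2 = n ->
  Lambda R K n y (translate s v) <-> Lambda R K n (y.1 - s, n) v.
Proof.
move=> yn; have d0 : (K ^ (n - v.2))%N%:Z != 0.
  by rewrite eqz_nat -lt0n expn_gt0 K_gt0.
have D : ((translate s v).1 %/ (K ^ (n - v.2))%N%:Z)%Z =
    s + (v.1 %/ (K ^ (n - v.2))%N%:Z)%Z by rewrite /= addrC divzMDl.
split=> [/(subtreeE _ yn)|/(@subtreeE (_, n) _ erefl)] [h1 h2].
  by apply/(@subtreeE (_, n) _ erefl); split=> //; rewrite /= h2 D addrC addKr.
by apply/(subtreeE _ yn); split=> //; rewrite D -h2 /= addrC subrK.
Qed.

Lemma supported_translate s phi y : y.2 = n -> supported phi y ->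
  supported (phi \o translate s) (y.1 - s, n).
Proof. by move=> yn sphi v /sphi /(subtree_translate _ _ yn). Qed.

Lemma adj_op_translate s phi y v : y.2 = n -> supported phi y ->
  (v.2 <= n)%N ->
  adj_op (canopy K) (phi \o translate s) v =
  adj_op (canopy K) phi (translate s v).
Proof.
move=> yn sphi vn; rewrite !adj_opE//; congr (_ + _).
  have [vn'|vn'] := ltnP v.2 n; first by rewrite /= parent_translate.
  by rewrite /= !(supported_above yn sphi)//=; lia.
rewrite [(translate s v).2]/=; case E : v.2 => [//|m]; apply: eq_bigr => j _.
by rewrite child_translate//= E// -E.
Qed.

(** An eigenvector of the adjacency matrix of the subtree, extended by zero. The
    eigenvalue equation then holds at every vertex of level at most [n], also
    outside the subtree. *)
Definition dirichlet_eigenfunction (a : R) y phi :=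
  supported phi y /\
  forall v, (v.2 <= n)%N -> adj_op (canopy K) phi v = a%:C%C * phi v.

Lemma dirichlet_eigenfunction_translate a s y phi : y.2 = n ->
  dirichlet_eigenfunction a y phi ->
  dirichlet_eigenfunction a (y.1 - s, n) (phi \o translate s).
Proof.
move=> yn [sphi ephi]; split; first exact: supported_translate.
by move=> v vn; rewrite (adj_op_translate _ yn sphi vn) ephi.
Qed.

(** The form of the adjacency operator that is compared with the product of a
    row vector and the adjacency matrix. *)
Lemma adj_op_finite (A : {fset cvertex}) phi z :
  (forall v, v \notin A -> phi v = 0) ->
  adj_op (canopy K) phi z = \sum_(v : A) (canopy K (val v) z)%:R * phi (val v).
Proof.
move=> phi0.
rewrite /adj_op fsbig_mkcond (@fsbigTE _ _ _ _ A) ?big_seq_fsetE/=; last first.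
  by move=> v vA; rewrite /patch phi0 ?if_same.
apply: eq_bigr => v _; rewrite /patch (_ : (_ \in _) = canopy K (val v) z).
  by case: ifP; rewrite ?mul1r ?mul0r.
have cs : canopy K (val v) z = canopy K z (val v) by rewrite /canopy orbC.
by rewrite cs; apply/idP/idP; rewrite in_setE => /gdist1; apply; exact: canopy_irr.
Qed.

Lemma sigma_Delta_eigenfunction a y : y.2 = n -> sigma_Delta K n y a ->
  exists2 phi, dirichlet_eigenfunction a y phi & exists z, phi z != 0.
Proof.
move=> yn /eigenvalueP[x xA /rV0Pn[i0 xi0]].
set A := fset_set (Lambda R K n y) in x xA i0 xi0.
have AE v : (v \in A) <-> Lambda R K n y v.
  by rewrite /A in_fset_set ?in_setE//; exact: (finite_Lambda R K_gt0).
pose phi v : R[i] := if insub v : option A is Some i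
  then (x 0 (enum_rank i))%:C%C else 0.
have phiE (i : A) : phi (val i) = (x 0 (enum_rank i))%:C%C by rewrite /phi valK.
have phi0 v : v \notin A -> phi v = 0 by move=> vA; rewrite /phi insubN.
exists phi; last first.
  by exists (val (enum_val i0)); rewrite phiE enum_valK
    -(rmorph0 (real_complex R)) (inj_eq (@complexI R)).
split=> [v|v vn]; first by rewrite -AE; apply: contraNT => /phi0 ->.
rewrite (adj_op_finite _ phi0).
have [vA|vA] := boolP (v \in A); last first.
  rewrite phi0// mulr0 big1// => i _.
  have [iv|] := boolP (canopy K (val i) v); last by rewrite mul0r.
  case/negP: vA; apply/AE; apply: subtree_adjacent yn vn iv _.
  by apply/AE; exact: valP.
pose j : A := [` vA]%fset.
have xj : (x *m adj_mx R (canopy K) A) 0 (enum_rank j) = a * x 0 (enum_rank j).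
  by rewrite xA mxE.
rewrite -[v]/(val j) phiE -[RHS](rmorphM (real_complex R)) -xj mxE rmorph_sum.
rewrite (reindex (@enum_val A predT))/=; last exact/onW_bij/enum_val_bij.
apply: eq_bigr => i _; rewrite phiE enum_valK !mxE enum_rankK rmorphM rmorph_nat.
by rewrite mulrC.
Qed.

(** Two leaves with the same parent have equal rows in the adjacency matrix; the
    difference of their indicator vectors is in the kernel. *)
Lemma sigma_Delta0 y : (1 < K)%N -> (0 < n)%N -> y.2 = n -> sigma_Delta K n y (0 : R).
Proof.
move=> K1 n0 yn; rewrite /sigma_Delta /=.
set A := fset_set (Lambda R K n y).
(* Descending [n] times from [y] reaches the leaves [y.1 * K ^ n + r]. *)
pose leaf (r : nat) : cvertex := (y.1 * (K ^ n)%N%:Z + r%:Z, 0%N).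
have KKn : (K <= K ^ n)%N by rewrite -{1}(expn1 K) leq_pexp2l//; lia.
have leafA r : (r < K)%N -> leaf r \in A.
  move=> rK; rewrite /A in_fset_set ?in_setE; last exact: (finite_Lambda R K_gt0).
  apply/(subtreeE _ yn); split => //=; rewrite subn0 divzMDl; last lia.
  by rewrite divz_small ?addr0//; lia.
pose i r (rK : (r < K)%N) := enum_rank [` leafA r rK]%fset.
have rows : row (i 0%N K_gt0) (adj_mx R (canopy K) A) =
            row (i 1%N K1) (adj_mx R (canopy K) A).
  apply/rowP => j; rewrite !mxE !enum_rankK /=; congr (_%:R).
  have leafP r w : (r < K)%N -> canopy K (leaf r) w = (w == parent K (leaf 0)).
    move=> rK; rewrite /canopy (_ : leaf r == _ = false) ?orbF; last first.
      by apply/eqP => /(congr1 snd).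
    congr (_ == _); rewrite /parent /=; congr pair.
    rewrite -(prednK n0) expnSr PoszM mulrA.
    by rewrite !divz_child.
  by rewrite !leafP.
apply/eigenvalueP; exists (delta_mx 0 (i 0%N K_gt0) - delta_mx 0 (i 1%N K1)).
  by rewrite mulmxBl -!rowE rows subrr scale0r.
apply/eqP => /rowP/(_ (i 0%N K_gt0)); rewrite !mxE !eqxx /=.
have -> : i 0%N K_gt0 == i 1%N K1 = false.
  apply/eqP => /enum_rank_inj /(congr1 val) /= /(congr1 fst) /=; lia.
by move/eqP; rewrite subr0 oner_eq0.
Qed.

End DirichletEigenfunctions.

(** * Eigenvectors of the random operator *)

Section SiblingEigenvectors.
Variables (R : realType) (K : nat).
Hypothesis K_gt0 : (0 < K)%N.
Implicit Types (v x y : cvertex) (u : cvertex -> R[i]).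

Lemma ell2_finite_support (V : choiceType) (A : set V) (f : V -> R[i]) :
  finite_set A -> (forall z, f z != 0 -> A z) -> ell2 f.
Proof.
move=> fA fsub; rewrite /ell2 /=.
rewrite (_ : (\esum_(z in [set: V]) _)%E =
             (\esum_(z in A) ((Normc.normc (f z)) ^+ 2)%:E)%E); last first.
  rewrite [RHS]esum_mkcond; apply: eq_esum => z _; case: ifPn => //.
  rewrite notin_setE => nAz; have [->|/fsub//] := eqVneq (f z) 0.
  by rewrite Normc.normc0 expr0n.
rewrite esum_fset//; last by move=> z _; rewrite lee_fin sqr_ge0.
by rewrite fsbig_finite// sumEFin ltry.
Qed.

Lemma blocks_disjoint l x x' v : sites l x -> sites l x' ->
  Lambda R K l x v -> Lambda R K l x' v -> x = x'.
Proof.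
move=> [m _ xm] [m' _ xm'] /(LambdaE R K_gt0)[h1 h2 h3].
move=> /(LambdaE R K_gt0)[h1' h2' h3']; rewrite /level /= in xm xm'.
(* Block [i] starts at level [i * l.+1], which exceeds the top level
   [j * l.+1 + l] of block [j] when [j < i]. *)
have le_index i j : (i * l.+1 <= j * l.+1 + l)%N -> (i <= j)%N.
  move=> h; rewrite leqNgt; apply/negP => ji.
  by have := leq_mul ji (leqnn l.+1); rewrite mulSn; lia.
have mm : m = m'.
  by apply/eqP; rewrite eqn_leq; apply/andP; split; apply: le_index; lia.
have xx : x.2 = x'.2 by rewrite xm xm' mm.
by rewrite [x]surjective_pairing [x']surjective_pairing h3 h3' xx.
Qed.

(** The blocks are disjoint, so only the coupling at [x] acts on [u]. *)
Lemma block_potential_supported l (w : cvertex -> R) x u :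
  sites l x -> (forall v, u v != 0 -> Lambda R K l x v) ->
  forall v, block_potential K l w u v = (w x)%:C%C * u v.
Proof.
move=> lx ux v; rewrite /block_potential (fsbigE [:: x])//=; last 2 first.
- by move=> z /=; rewrite inE => /eqP ->.
- move=> x' lx' /negP xx'; rewrite /Defs.proj.
  have [/set_mem x'v|_] := boolP (v \in Lambda R K l x'); last by rewrite mulr0.
  have [->|/ux xv] := eqVneq (u v) 0; first by rewrite mulr0.
  by case: xx'; rewrite inE (blocks_disjoint lx' lx x'v xv).
rewrite big_cons big_nil ifT ?in_setE// addr0 /Defs.proj.
have [//|/negP nxv] := boolP (v \in Lambda R K l x).
have [->//|/ux xv] := eqVneq (u v) 0.
by case: nxv; rewrite in_setE.
Qed.

Lemma adj_opB u u' v :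
  adj_op (canopy K) (fun z => u z - u' z) v =
  adj_op (canopy K) u v - adj_op (canopy K) u' v.
Proof.
rewrite !adj_opE//; case: (v.2) => [|_]; first by rewrite !addr0.
by rewrite sumrB opprD addrACA.
Qed.

Lemma subtree_child n x j v : x.2 = n.+1 -> (j < K)%N ->
  Lambda R K n (child K x j) v -> Lambda R K n.+1 x v.
Proof.
move=> xn jK; have cn : (child K x j).2 = n by rewrite /= xn.
move=> /(subtreeE R K_gt0 _ cn)[vn cE]; apply/(subtreeE R K_gt0 _ xn).
split; first by lia.
by rewrite subSn// expnSr PoszM divzMA_ge0// -cE divz_child.
Qed.

(** Inside the two subtrees both functions satisfy the eigenvalue equation with
    [a]; above them each contributes its value at the root, at [x] only, and
    these values are equal. *)
Lemma sibling_difference_eigenvector n (w : cvertex -> R) a x (j j' : nat) u u' :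
  x.2 = n.+1 -> (j < K)%N -> (j' < K)%N ->
  dirichlet_eigenfunction K n a (child K x j) u ->
  dirichlet_eigenfunction K n a (child K x j') u' ->
  u (child K x j) = u' (child K x j') ->
  eigenker (canopy_dom K n.+1 w) (canopy_H K n.+1 w) (a + w x)
    (fun v => u v - u' v).
Proof.
move=> xn jK j'K [su eu] [su' eu'] uu'; set f := fun v => _.
have cn i : (child K x i).2 = n by rewrite /= xn.
have xp i : (i < K)%N -> x = parent K (child K x i).
  by move=> iK; apply/(canopy_childP K_gt0); rewrite xn; split=> //; exists (Ordinal iK).
have sf v : f v != 0 -> Lambda R K n.+1 x v.
  rewrite /f; have [->|/su /(subtree_child xn jK)//] := eqVneq (u v) 0.
  have [->|/su' /(subtree_child xn j'K)//] := eqVneq (u' v) 0.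
  by rewrite subrr eqxx.
have bf := block_potential_supported w (_ : sites n.+1 x) sf.
have {}bf v : block_potential K n.+1 w f v = (w x)%:C%C * f v.
  by apply: bf; exists 0%N.
split.
  split; apply: (ell2_finite_support (finite_Lambda R K_gt0 n.+1 x)) => // v.
  by rewrite bf mulf_eq0 => /norP[_ /sf].
move=> v; rewrite /canopy_H bf rmorphD mulrDl; congr (_ + _).
rewrite /f adj_opB; have [vn|nv] := leqP v.2 n.
  by rewrite eu// eu'// -mulrBr.
rewrite (supported_above K_gt0 (cn j) su nv).
rewrite (supported_above K_gt0 (cn j') su' nv) subrr mulr0.
rewrite (adj_op_above_subtree K_gt0 (cn j) su nv).
rewrite (adj_op_above_subtree K_gt0 (cn j') su' nv) -!xp// uu'.
by rewrite subrr.
Qed.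

(** Translating one eigenfunction to all subtrees below [x] makes the root
    values agree.  Independence is read off at a translate of [z] inside the
    subtree of child [i.+1], where all other translates vanish. *)
Lemma independent_eigenvectors n (w : cvertex -> R) a x y :
  x.2 = n.+1 -> y.2 = n -> sigma_Delta K n y a ->
  exists2 f : 'I_K.-1 -> cvertex -> R[i],
    (forall i, eigenker (canopy_dom K n.+1 w) (canopy_H K n.+1 w)
                 (a + w x) (f i)) & lin_indep f.
Proof.
move=> xn yn /(sigma_Delta_eigenfunction K_gt0 yn)[phi ephi [z phiz]].
(* [translate (s j)] maps child [j] of [x] to [y]. *)
pose s j : int := y.1 - (child K x j).1.
pose g j := phi \o translate K n (s j).
have cn j : (child K x j).2 = n by rewrite /= xn.
have eg j : dirichlet_eigenfunction K n a (child K x j) (g j).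
  have -> : child K x j = (y.1 - s j, n).
    by rewrite /s opprB addrC subrK -(cn j).
  exact: dirichlet_eigenfunction_translate.
have gc j : g j (child K x j) = phi y.
  rewrite /g /= /translate cn subnn expn0 mulr1 /s addrC subrK -yn.
  by rewrite -surjective_pairing.
have iK (i : 'I_K.-1) : (i.+1 < K)%N by have := ltn_ord i; lia.
exists (fun i v => g i.+1 v - g 0%N v) => [i|c c0 i].
  by apply: (sibling_difference_eigenvector _ xn (iK i) K_gt0); rewrite ?gc.
pose v := translate K n (- s i.+1) z.
have gi : g i.+1 v = phi z.
  by rewrite /g /v /= /translate /= mulNr subrK -surjective_pairing.
have gj j : j != i.+1 -> g j v = 0.
  move=> ji; have [//|] := eqVneq (g j v) 0.
  move=> /((eg j).1) /(subtreeE R K_gt0 _ (cn j))[_ Ej].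
  have : g i.+1 v != 0 by rewrite gi.
  move=> /((eg i.+1).1) /(subtreeE R K_gt0 _ (cn _))[_].
  by rewrite -Ej => /addrI[] ij; rewrite ij eqxx in ji.
have := c0 v; rewrite (bigD1 i)//= big1 => [|k ki].
  rewrite addr0 gi gj// subr0 => /eqP; rewrite mulf_eq0 (negPf phiz) orbF.
  by move/eqP.
by rewrite !gj ?subr0 ?mulr0//.
Qed.

End SiblingEigenvectors.

Lemma le_dimension (R : realType) (V : choiceType) (S : set (V -> R[i])) m
    (f : 'I_m -> V -> R[i]) :
  (forall i, S (f i)) -> lin_indep f -> (m%:R%:E <= dimension S)%E.
Proof. by move=> Sf fi; apply: ereal_sup_ubound; exists m => //; exists f. Qed.

Lemma lin_indep_neq0 (R : realType) (V : choiceType) m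
    (f : 'I_m -> V -> R[i]) i : lin_indep f -> exists v, f i v != 0.
Proof.
move=> fi; apply: contrapT => /forallNP f0.
have c0 v : \sum_(j < m) (j == i)%:R * f j v = 0.
  rewrite (bigD1 i)//= big1 ?addr0 => [|j /negPf ->]; last by rewrite mul0r.
  by have /negP := f0 v; rewrite negbK => /eqP ->; rewrite mulr0.
by have /eqP := fi _ c0 i; rewrite eqxx oner_eq0.
Qed.

(** * Almost sure values of the random couplings *)

Section RandomCouplings.
Context d (T : measurableType d) (R : realType) (P : probability T R).
Variable mu : probability (measurableTypeR R) R.

Lemma ae_forall_rat (Q : rat -> rat -> T -> Prop) :
  (forall c r, {ae P, forall t, Q c r t}) ->
  {ae P, forall t, forall c r, Q c r t}.
Proof.
move=> aeQ; pose Q' (n : nat) (t : T) :=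
  if (choice.unpickle n : option (rat * rat)) is Some p
  then Q p.1 p.2 t else True.
have : {ae P, forall t, forall n, Q' n t}.
  apply: ae_foralln => n; rewrite /Q'.
  by case: (choice.unpickle n) => [p|]; [exact: aeQ|exact: aeW].
apply: filterS => t Qt c r; have := Qt (choice.pickle (c, r)).
by rewrite /Q' choice.pickleK.
Qed.

(** The complement of the support is a countable union of null balls with
    rational data. *)
Lemma ae_msupp (X : {RV P >-> R}) :
  (forall B, measurable B -> distribution P X B = mu B) ->
  {ae P, forall t, msupp mu (X t)}.
Proof.
move=> Xmu.
have : {ae P, forall t, forall c r : rat,
    mu (ball (ratr c : R) (ratr r)) = 0%E -> ~ ball (ratr c : R) (ratr r) (X t)}.
  apply: ae_forall_rat => c r.
  have [B0|B0] := eqVneq (mu (ball (ratr c : R) (ratr r))) 0%E; last first.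
    by apply: aeW => t E; rewrite E eqxx in B0.
  exists (X @^-1` ball (ratr c : R) (ratr r)); split.
  - by apply: measurable_funPTI; exact: measurable_ball.
  - have := Xmu _ (measurable_ball (ratr c) (ratr r)).
    by rewrite B0.
  - by move=> t /= h; apply: contrapT => nb; apply: h.
apply: filterS => t Ht U oU UX.
have [c [r [/set_mem XB BU]]] := open_subball_rat oU (mem_set UX).
rewrite lt0e measure_ge0 andbT; apply/eqP => U0.
apply: (Ht c r _ XB); apply/eqP; rewrite -measure_le0 -U0.
by apply: le_measure => //; apply/mem_set;
  [exact: measurable_ball|exact: open_measurable].
Qed.

Variables (I : choiceType) (A : set I) (X : I -> {RV P >-> R}).
Hypothesis indepX : mutually_independent A X.
Hypothesis distrX : identically_distributed A X mu.
Variable xs : nat -> I.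
Hypothesis xs_inj : injective xs.
Hypothesis xsA : forall n, A (xs n).

(** Independence bounds the probability that the first [m] variables miss [U] by
    [q ^+ m], where [q < 1] is the measure of the complement of [U]. *)
Lemma ae_hits (U : set R) : measurable (U : set (measurableTypeR R)) ->
  (0 < mu U)%E -> {ae P, forall t, exists n, U (X (xs n) t)}.
Proof.
move=> mU muU; pose N := \bigcap_n (X (xs n) @^-1` (~` U)).
have mX n : measurable (X (xs n) @^-1` (~` U)).
  by apply: measurable_funPTI; exact: measurableC.
have mN : measurable N by exact: bigcapT_measurable.
pose q := fine (mu (~` U)).
have qE : mu (~` U) = q%:E by rewrite fineK// fin_num_measure//; exact: measurableC.
have q0 : 0 <= q by rewrite -lee_fin -qE.
have q1 : q < 1.
  rewrite -lte_fin -qE probability_setC// lteBlDr ?fin_num_measure//.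
  by rewrite lteDl// ltry.
have Nq m : (P N <= (q ^+ m)%:E)%E.
  pose J := [fset xs k | k in iota 0 m]%fset.
  have JP i : i \in J -> exists k, i = xs k.
    by move=> /imfsetP[k _ ->]; exists k.
  have -> : ((q ^+ m)%:E = \prod_(i <- J) P (X i @^-1` (~` U)))%E.
    rewrite (eq_big_seq (fun=> q%:E)) => [|i /JP[k ->]]; last first.
      by rewrite -qE; apply: distrX => //; exact: measurableC.
    have -> : m = size J.
      by rewrite [size _]card_imfset//= undup_id ?iota_uniq// size_iota.
    elim: (J : seq I) => [|i r IH]; first by rewrite big_nil.
    by rewrite big_cons -IH exprS EFinM.
  have <- := @indepX J (fun=> ~` U).
  - apply: le_measure; [exact/mem_set| |].
      apply/mem_set/fin_bigcap_measurable => [|i /JP[k ->]]; last exact: mX.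
      exact: finite_fset.
    by move=> t Nt i /= /JP[k ->]; exact: Nt.
  - by move=> i /JP[k ->].
  - by move=> i; exact: measurableC.
exists N; split => //.
  apply/eqP; rewrite eq_le measure_ge0 andbT leNgt; apply/negP => N0.
  have NE : P N = (fine (P N))%:E by rewrite fineK// fin_num_measure.
  rewrite NE lte_fin in N0.
  have q1' : `|q| < 1 by rewrite ger0_norm.
  have /cvgrPdist_lt/(_ _ N0)[m _ /(_ m (leqnn m))] := cvg_expr q1'.
  rewrite /= sub0r normrN ger0_norm ?exprn_ge0//.
  by have := Nq m; rewrite NE lee_fin => /le_lt_trans h /h; rewrite ltxx.
by move=> t /= /forallNP h n _; exact: h.
Qed.

(** It suffices to hit the countably many rational balls of positive measure. *)
Lemma ae_dense_msupp : {ae P, forall t, forall s, msupp mu s ->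
  forall U, open U -> U s -> exists n, U (X (xs n) t)}.
Proof.
have : {ae P, forall t, forall c r : rat,
    (0 < mu (ball (ratr c : R) (ratr r)))%E ->
    exists n, ball (ratr c : R) (ratr r) (X (xs n) t)}.
  apply: ae_forall_rat => c r.
  have [B0|/negP B0] := boolP (0 < mu (ball (ratr c : R) (ratr r)))%E.
    have := ae_hits (measurable_ball (ratr c) (ratr r)) B0.
    by apply: filterS => t Ht _.
  exact: aeW.
apply: filterS => t Ht s ss U oU Us.
have [c [r [/set_mem sB BU]]] := open_subball_rat oU (mem_set Us).
have [n Bn] := Ht c r (ss _ (ball_open _ _) sB).
by exists n; exact: BU.
Qed.

End RandomCouplings.

(** * Point spectrum *)

Theorem theorem2p2 (R : realType) (K l : nat) (hK : (2 < K)%N) (hl : (2 <= l)%N)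
  (d : measure_display) (T : measurableType d) (P : probability T R)
  (mu : probability (measurableTypeR R) R)
  (omega : cvertex -> {RV P >-> R})
  (hindep : mutually_independent (sites l) omega)
  (hdistr : identically_distributed (sites l) omega mu)
  (hac : mu `<< lebesgue_measure)
  (x0 : cvertex) (hx0 : level l.-1 x0) :
  {ae P, forall t,
    let w := fun x => omega x t in
    let S := setadd (sigma_Delta K l.-1 x0) (msupp mu) in
    S `<=` sigma_pp (canopy_dom K l w) (canopy_H K l w) /\
    ((K.-1)%:R%:E <=
       ereal_sup [set dimension (eigenker (canopy_dom K l w) (canopy_H K l w)
                                   lambda) | lambda in S])%E}.

Proof.
have K_gt0 : (0 < K)%N by lia.
case: l hl hindep hdistr hx0 => [//|n] /= hl' indep distr xn.
have x0n : x0.2 = n by [].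
pose xs i : cvertex := (Posz i, n.+1).
have xsS i : sites n.+1 (xs i) by exists 0%N.
have xs_inj : injective xs by move=> i j [].
have := ae_dense_msupp indep distr xs_inj xsS.
have := ae_msupp (distr _ (xsS 0%N)).
apply: filterS2 => t supp0 dense; pose w x := omega x t; split.
  move=> _ [a aD [s ss <-]] B /nbhs_ballP[e /= e0 aB].
  have [i si] := dense s ss _ (ball_open s e) (ballxx _ e0).
  have [f fe fi] := independent_eigenvectors K_gt0 w (erefl : (xs i).2 = _) x0n aD.
  have K1 : (0 < K.-1)%N by lia.
  exists (a + w (xs i)); split.
    by exists (f (Ordinal K1)); [exact: fe|exact: lin_indep_neq0].
  by apply: aB; move: si; rewrite -!ball_normE /= opprD addrACA subrr add0r.
have D0 := sigma_Delta0 R K_gt0 (ltac:(lia) : (1 < K)%N) (hl' : (0 < n)%N) x0n.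
have [f fe fi] := independent_eigenvectors K_gt0 w (erefl : (xs 0%N).2 = _) x0n D0.
apply: (le_trans (le_dimension fe fi)); apply: ereal_sup_ubound.
by exists (0 + w (xs 0%N)) => //; exists 0 => //; exists (w (xs 0%N)).
Qed.
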